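(* Let $f:\{0,1\}^n\to\{0,1\}$ be a non-constant monotone Boolean function. Then \[ \mathrm{Arith}\big(\mathrm{Env}(\mathrm{Low}(f))\big)\leq \mathrm{Read}_1(f)\leq \mathrm{sRead}_1(f)\leq \mathrm{Arith}(\mathrm{Low}(f)). \] In particular, if $f$ is homogeneous, then $\mathrm{Arith}(\mathrm{Low}(f))=\mathrm{Read}_1(f)=\mathrm{sRead}_1(f)$.
   Context: A monotone Boolean circuit is a directed acyclic graph (parallel edges allowed) whose indegree-zero nodes hold variables among $x_1,\dots,x_n$ (no constant inputs) and whose other nodes (gates) have indegree two and are labeled $\lor$ or $\land$; its size is the number of gates. The set $B_F\subseteq\mathbb{N}^n$ of exponent vectors produced by a circuit $F$ is defined inductively: for $F=x_i$, $B_F=\{e_i\}$ (the $i$th unit vector); for $F=G\lor H$, $B_F=B_G\cup B_H$; for $F=G\land H$, $B_F=B_G+B_H=\{b+c: b\in B_G, c\in B_H\}$. (For an arithmetic $(+,\times)$ circuit the same rules with $+$ in place of $\lor$ and $\times$ in place of $\land$ give the set of exponent vectors of the polynomial it produces, i.e. the formal expansion without any cancellation or merging of terms.) The support of $a\in\mathbb{N}^n$ is $\mathrm{supp}(a)=\{i:a_i\neq 0\}$. For a monotone Boolean function $f$, $\mathrm{Low}(f)$ is the set of $a\in\{0,1\}^n$ with $f(a)=1$ and $f(b)=0$ for all $b\leq a$, $b\neq a$ (componentwise order). A monotone Boolean circuit $F$ computing $f$ is a read-$k$ circuit if for every $a\in\mathrm{Low}(f)$ there is $b\in B_F$ with $\mathrm{supp}(b)=\mathrm{supp}(a)$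 and $b_i\leq k$ for all $i$; it is syntactically read-$k$ if every vector in $B_F$ has all entries $\leq k$. $\mathrm{Read}_k(f)$ (resp. $\mathrm{sRead}_k(f)$) is the minimum size of a monotone read-$k$ (resp. syntactically read-$k$) circuit computing $f$. For a finite $A\subseteq\mathbb{N}^n$, $\mathrm{Arith}(A)$ is the minimum size of a monotone arithmetic $(+,\times)$ circuit with only variables as inputs that produces a polynomial $\sum_{a\in A}c_a\prod_i x_i^{a_i}$ with integer coefficients $c_a\geq 1$ (i.e. whose set of produced exponent vectors is exactly $A$). The degree of $a\in\mathbb{N}^n$ is $|a|=a_1+\dots+a_n$, and the lower envelope $\mathrm{Env}(A)$ is the set of vectors of $A$ of minimum degree. $f$ is homogeneous if all vectors in $\mathrm{Low}(f)$ have the same degree. *)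

(* Defs.v *)
From mathcomp Require Import all_boot all_order all_algebra.
From mathcomp Require Import finmap mpoly.

Set Implicit Arguments.
Unset Strict Implicit.
Unset Printing Implicit Defensive.

Import Order.TTheory GRing.Theory Num.Theory.

Local Open Scope fset_scope.
Local Open Scope ring_scope.

(** [gAdd] is the label \/ of a Boolean circuit and + of an arithmetic one;
    [gMul] is /\, resp. *.  Boolean and arithmetic circuits are the same labeled
    dags and differ only in the interpretation of the labels. *)
Inductive label : Type := gAdd | gMul.

(** A circuit dag with [s] gates, listed in a topological order: every wire of a
    new gate leaves a variable ([inl i]) or one of the [s] earlier gates
    ([inr j]).  The two wires may coincide, gates may have any fan-out, and
    there are no constant inputs. *)
Inductive gates (n : nat) : nat -> Type :=
| NoGate : gates n 0
| AddGate s of gates n s & label & 'I_n + 'I_s & 'I_n + 'I_s : gates n s.+1.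

Arguments NoGate {n}.

Record circuit (n : nat) : Type := Circuit {
  csize : nat;
  cgates : gates n csize;
  coutput : 'I_n + 'I_csize
}.

Section Evaluation.
Variables (n : nat) (T : Type) (x : 'I_n -> T) (add mul : T -> T -> T).

Definition wire_val s (v : 'I_s -> T) (w : 'I_n + 'I_s) : T :=
  match w with inl i => x i | inr j => v j end.

Definition label_op (l : label) : T -> T -> T :=
  match l with gAdd => add | gMul => mul end.

Fixpoint gate_val s (g : gates n s) : 'I_s -> T :=
  match g in gates _ s return 'I_s -> T with
  | NoGate => fun j => match notF (ltn_ord j) with end
  | AddGate s g l u w => fun j =>
      if unlift ord_max j is Some j' then gate_val g j'
      else label_op l (wire_val (gate_val g) u) (wire_val (gate_val g) w)
  end.

Definition ceval (F : circuit n) : T :=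
  wire_val (gate_val (cgates F)) (coutput F).

End Evaluation.

(** Points of {0,1}^n are [{ffun 'I_n -> bool}], vectors of N^n are the
    monomials ['X_{1..n}], whose addition is componentwise. *)

Definition point_le n (a b : {ffun 'I_n -> bool}) : bool :=
  [forall i, a i ==> b i].

Definition monotone_fun n (f : {ffun 'I_n -> bool} -> bool) : Prop :=
  forall a b, point_le a b -> f a -> f b.

Definition constant_fun n (f : {ffun 'I_n -> bool} -> bool) : Prop :=
  exists c : bool, forall a, f a = c.

Definition vec n (a : {ffun 'I_n -> bool}) : 'X_{1..n} :=
  [multinom nat_of_bool (a i) | i < n].

Definition Low n (f : {ffun 'I_n -> bool} -> bool) : {fset 'X_{1..n}} :=
  [fset vec a | a in [pred a | f a &&
     [forall b, point_le b a && (b != a) ==> ~~ f b]]].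

Definition supp n (a : 'X_{1..n}) : {set 'I_n} := [set i | a i != 0%N].

Definition Env n (A : {fset 'X_{1..n}}) : {fset 'X_{1..n}} :=
  [fset a in A | all (fun b => mdeg a <= mdeg b)%N (enum_fset A)].

Definition homogeneous_fun n (f : {ffun 'I_n -> bool} -> bool) : Prop :=
  forall a b, a \in Low f -> b \in Low f -> mdeg a = mdeg b.

Definition bool_val n (F : circuit n) (a : {ffun 'I_n -> bool}) : bool :=
  ceval a orb andb F.

Definition computes n (F : circuit n) (f : {ffun 'I_n -> bool} -> bool) : Prop :=
  forall a, bool_val F a = f a.

(** The set B_F of exponent vectors produced by F. *)
Definition produced n (F : circuit n) : {fset 'X_{1..n}} :=
  ceval (fun i => [fset U_(i)%MM])
        (fun B C => B `|` C)
        (fun B C => [fset (b + c)%MM | b in B, c in C]) F.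

Definition arith_poly n (F : circuit n) : {mpoly int[n]} :=
  ceval (fun i => 'X_i) +%R *%R F.

Definition read_circuit n k (F : circuit n)
    (f : {ffun 'I_n -> bool} -> bool) : Prop :=
  computes F f /\
  forall a, a \in Low f ->
    exists b, [/\ b \in produced F, supp b = supp a & forall i, (b i <= k)%N].

Definition sread_circuit n k (F : circuit n)
    (f : {ffun 'I_n -> bool} -> bool) : Prop :=
  computes F f /\ forall b, b \in produced F -> forall i, (b i <= k)%N.

Definition arith_circuit n (F : circuit n) (A : {fset 'X_{1..n}}) : Prop :=
  exists c : 'X_{1..n} -> int,
    (forall a, a \in A -> 1 <= c a) /\
    arith_poly F = \sum_(a <- enum_fset A) c a *: 'X_[a].

(** Minimum sizes are relations, since the minimum is undefined when no circuit
    qualifies; for instance no circuit produces the empty set of vectors. *)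
Definition is_min_size n (P : circuit n -> Prop) (s : nat) : Prop :=
  (exists F, P F /\ csize F = s) /\ (forall F, P F -> (s <= csize F)%N).

Definition is_Read n k (f : {ffun 'I_n -> bool} -> bool) : nat -> Prop :=
  is_min_size (fun F => read_circuit k F f).

Definition is_sRead n k (f : {ffun 'I_n -> bool} -> bool) : nat -> Prop :=
  is_min_size (fun F => sread_circuit k F f).

Definition is_Arith n (A : {fset 'X_{1..n}}) : nat -> Prop :=
  is_min_size (fun F => arith_circuit F A).

(* Main.v *)
(** A monotone circuit has no cancellation, so an arithmetic circuit for [A] is
    one whose produced set is exactly [A], and a Boolean circuit is true at [a]
    iff the support of some produced vector lies below [a].  Hence a circuit
    producing [Low f] is syntactically read-1 and computes [f].  Conversely, a
    read-1 circuit for [f] produces all of [Low f], and every vector it produces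
    lies above one of [Low f], so both sets have the same lower envelope.  Lower
    envelopes commute with sums, and the envelope of a union is the envelope of
    one part or the union of both, so bypassing some union gates yields a
    circuit for the envelope that is no larger. *)

Require Import Defs.
From mathcomp Require Import all_boot all_order all_algebra.
From mathcomp Require Import finmap mpoly.
From Stdlib Require Import Classical.

Set Implicit Arguments.
Unset Strict Implicit.
Unset Printing Implicit Defensive.

Import Order.TTheory GRing.Theory Num.Theory.

Local Open Scope fset_scope.

(** * Comparing two evaluations of the same circuit *)

Section Parametricity.
Variables (n : nat) (T U : Type) (x : 'I_n -> T) (y : 'I_n -> U).
Variables (addT mulT : T -> T -> T) (addU mulU : U -> U -> U).
Variable R : T -> U -> Prop.
Hypothesis R_var : forall i, R (x i) (y i).
Hypothesis R_add : forall a b c d, R a b -> R c d -> R (addT a c) (addU b d).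
Hypothesis R_mul : forall a b c d, R a b -> R c d -> R (mulT a c) (mulU b d).

(** A relation compatible with variables and both operations passes through every gate. Two
    instances of this principle link the produced set to the polynomial and to the Boolean value. *)
Lemma gate_val_rel s (g : gates n s) (j : 'I_s) :
  R (gate_val x addT mulT g j) (gate_val y addU mulU g j).
Proof.
elim: g j => [[]//|{}s g IH l u w j] /=.
have wire v : R (wire_val x (gate_val x addT mulT g) v)
                (wire_val y (gate_val y addU mulU g) v) by case: v => /=.
case: unliftP => [j' _|_]; first exact: IH.
by case: l; [apply: R_add|apply: R_mul].
Qed.

Lemma ceval_rel (F : circuit n) : R (ceval x addT mulT F) (ceval y addU mulU F).
Proof.
by case: F => s g [i|j]; rewrite /ceval /=; [apply: R_var|apply: gate_val_rel].
Qed.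

End Parametricity.

(** * Combining circuits *)

Definition lift_wire n s (v : 'I_n + 'I_s) : 'I_n + 'I_s.+1 :=
  match v with inl i => inl i | inr j => inr (lift ord_max j) end.

Section Append.
Variables (n : nat) (T : Type) (x : 'I_n -> T) (add mul : T -> T -> T).
Let val s (g : gates n s) := wire_val x (gate_val x add mul g).

Lemma wire_val_lift s (g : gates n s) l u w (v : 'I_n + 'I_s) :
  val (AddGate g l u w) (lift_wire v) = val g v.
Proof. by case: v => [//|j]; rewrite /val /= liftK. Qed.

Lemma wire_val_new s (g : gates n s) l u w :
  val (AddGate g l u w) (inr ord_max) = label_op add mul l (val g u) (val g w).
Proof. by rewrite /val /= unlift_none. Qed.

(** The gates of [h] are added one by one on top of [g]; [phi] and [psi] record where the old wires
    end up. No bound on [r] is stated, as this serves only to show that circuits exist. *)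
Lemma gates_append s t (g : gates n s) (h : gates n t) :
  exists r (k : gates n r) (phi : 'I_n + 'I_s -> 'I_n + 'I_r)
         (psi : 'I_n + 'I_t -> 'I_n + 'I_r),
    (forall v, val k (phi v) = val g v) /\ (forall v, val k (psi v) = val h v).
Proof.
elim: h => [|{}t h [r [k [phi [psi [phiE psiE]]]]] l u w].
  exists s, g, id, (fun v : 'I_n + 'I_0 => match v with
    | inl i => inl i | inr j => match notF (ltn_ord j) with end end).
  by split=> [v|[i|[]]].
exists r.+1, (AddGate k l (psi u) (psi w)).
exists (@lift_wire n r \o phi), (fun v => match v with
  | inl i => inl i
  | inr j => if unlift ord_max j is Some j' then lift_wire (psi (inr j'))
             else inr ord_max end).
split=> [v|[//|j]]; first by rewrite wire_val_lift.
case: unliftP => [j' ->|->]; first by rewrite wire_val_lift psiE /val /= liftK.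
by rewrite !wire_val_new !psiE.
Qed.

Lemma circuit_op l (F G : circuit n) : exists H : circuit n,
  ceval x add mul H = label_op add mul l (ceval x add mul F) (ceval x add mul G).
Proof.
have [r [k [phi [psi [phiE psiE]]]]] := gates_append (cgates F) (cgates G).
exists (Circuit (AddGate k l (phi (coutput F)) (psi (coutput G))) (inr ord_max)).
by rewrite {1}/ceval [LHS]wire_val_new phiE psiE.
Qed.

End Append.

(** * Produced vectors, polynomials and Boolean values *)

Section Produced.
Variable n : nat.
Implicit Types (A B C : {fset 'X_{1..n}}) (F G : circuit n) (a b c m : 'X_{1..n}).

Definition sumset B C : {fset 'X_{1..n}} := [fset (b + c)%MM | b in B, c in C].

Lemma sumsetP B C m :
  reflect (exists b c, [/\ b \in B, c \in C & m = (b + c)%MM]) (m \in sumset B C).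
Proof.
apply: (iffP (imfset2P _ _ _ _ _)) => [[b bB [c cC ->]]|[b [c [bB cC ->]]]].
  by exists b, c.
by exists b => //; exists c.
Qed.

Lemma producedE F :
  produced F = ceval (fun i => [fset U_(i)%MM]) (fun B C => B `|` C) sumset F.
Proof. by []. Qed.

(** Nonnegativity belongs to the invariant because it is what rules out cancellation. *)
Definition supports (p : {mpoly int[n]}) B : Prop :=
  forall m, (0 <= p@_m)%R /\ ((p@_m == 0)%R = (m \notin B)).

Lemma arith_poly_supports F : supports (arith_poly F) (produced F).
Proof.
rewrite producedE; apply: ceval_rel => [i m|p B q C pB qC m|p B q C pB qC m].
- rewrite mcoeffX inE; split; first by case: (_ == _).
  by rewrite [m == _]eq_sym; case: (_ == m).
- have [p0 pE] := pB m; have [q0 qE] := qC m.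
  by rewrite mcoeffD addr_ge0 // paddr_eq0 // pE qE inE negb_or.
- rewrite mcoeffM.
  have t_ge0 (k : 'X_{1..n < (mdeg m).+1, (mdeg m).+1}) :
    (0 <= p@_k.1 * q@_k.2)%R.
    by apply: mulr_ge0; [case: (pB k.1)|case: (qC k.2)].
  split; first exact: sumr_ge0.
  (* A sum of nonnegative terms vanishes only if each term does. The sum ranges over pairs of
     monomials of degree at most [mdeg m], so [b] and [c] must be shown to lie in that range. *)
  rewrite psumr_eq0 //; apply/allP/negP => [h /sumsetP[b [c [bB cC mE]]]|h k _].
    have bm : (mdeg b < (mdeg m).+1)%N by rewrite mE mdegD ltnS leq_addr.
    have cm : (mdeg c < (mdeg m).+1)%N by rewrite mE mdegD ltnS leq_addl.
    have := h (BMultinom bm, BMultinom cm) (mem_index_enum _).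
    rewrite /= mE eqxx /= mulf_eq0; have [_ ->] := pB b; have [_ ->] := qC c.
    by rewrite bB cC.
  apply/implyP => /eqP mE; rewrite mulf_eq0.
  have [_ ->] := pB k.1; have [_ ->] := qC k.2.
  rewrite -negb_and; apply/negP => /andP[kB kC]; apply: h.
  by apply/sumsetP; exists k.1, k.2.
Qed.

Lemma mcoeff_sum_fset A (c : 'X_{1..n} -> int) m :
  ((\sum_(a <- enum_fset A) c a *: 'X_[a])@_m = if m \in A then c m else 0)%R.
Proof.
rewrite raddf_sum /=; case: ifP => [mA|mA].
  rewrite (big_fsetD1 m) //= mcoeffZ mcoeffX eqxx mulr1 big1_fset ?addr0 // => a.
  by rewrite !inE => /andP[am _] _; rewrite mcoeffZ mcoeffX (negPf am) mulr0.
rewrite big1_seq // => a /andP[_ aA]; rewrite mcoeffZ mcoeffX.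
by case: eqP => [am|]; [rewrite -am aA in mA|rewrite mulr0].
Qed.

Lemma arith_circuitP F A : arith_circuit F A <-> produced F = A.
Proof.
have suppF := arith_poly_supports F.
split=> [[c [c_ge1 FE]]|<-].
  apply/fsetP => m; have [_] := suppF m.
  rewrite FE mcoeff_sum_fset; case: ifP => [mA|_].
    have := c_ge1 _ mA; case: eqP => [->//|_ _].
    by move/esym/negbFE.
  by rewrite eqxx => /esym/negbTE.
(* The coefficients of the polynomial itself serve as [c]: a positive integer is at least 1. *)
exists (fun m => (arith_poly F)@_m)%R; split=> [a aF|].
  have [] := suppF a; rewrite aF le0r => /orP[->//|]; by rewrite gtz0_ge1.
apply/mpolyP => m; rewrite mcoeff_sum_fset; case: ifP => // mF.
by have [_] := suppF m; rewrite mF => /eqP.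
Qed.

Definition supp_point m : {ffun 'I_n -> bool} := [ffun i => m i != 0%N].

Lemma supp_pointD b c (a : {ffun 'I_n -> bool}) :
  point_le (supp_point (b + c)%MM) a
  = point_le (supp_point b) a && point_le (supp_point c) a.
Proof.
apply/forallP/andP => [h|[/forallP hb /forallP hc] i].
  by split; apply/forallP => i; have := h i; rewrite !ffunE mnmDE addn_eq0;
    case: (b i == 0%N); case: (c i == 0%N).
by have := hb i; have := hc i; rewrite !ffunE mnmDE addn_eq0;
  case: (b i == 0%N); case: (c i == 0%N).
Qed.

(** In the conjunction case, the support of [b + c] is the union of the two supports, so it lies
    below [a] exactly when both do. *)
Lemma bool_valP F (a : {ffun 'I_n -> bool}) :
  bool_val F a <-> exists2 b, b \in produced F & point_le (supp_point b) a.
Proof.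
rewrite producedE.
apply: (ceval_rel (R := fun (t : bool) (B : {fset 'X_{1..n}}) =>
   t <-> exists2 b, b \in B & point_le (supp_point b) a)).
- move=> i; split=> [ai|[b]].
    exists U_(i)%MM; first by rewrite inE.
    by apply/forallP => j; rewrite ffunE mnm1E; case: (eqVneq i j) => [<-|].
  rewrite inE => /eqP -> /forallP/(_ i).
  by rewrite ffunE mnm1E eqxx.
- move=> s B t C sB tC; split=> [/orP[/sB|/tC] [b bB ba]|[b]].
  + by exists b; rewrite // inE bB.
  + by exists b; rewrite // inE bB orbT.
  + by rewrite inE => /orP[bB|bC] ba; apply/orP; [left; apply/sB|right; apply/tC];
      exists b.
- move=> s B t C sB tC; split=> [/andP[/sB[b bB ba] /tC[c cC ca]]|[m]].
    by exists (b + c)%MM; rewrite ?supp_pointD ?ba //; apply/sumsetP; exists b, c.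
  case/sumsetP => b [c [bB cC ->]]; rewrite supp_pointD => /andP[ba ca].
  by apply/andP; split; [apply/sB; exists b|apply/tC; exists c].
Qed.

Lemma point_le_refl (a : {ffun 'I_n -> bool}) : point_le a a.
Proof. by apply/forallP => i; apply: implybb. Qed.

Lemma produced_true F m : m \in produced F -> bool_val F (supp_point m).
Proof. by move=> mF; apply/bool_valP; exists m => //; apply: point_le_refl. Qed.

(** * Lower envelopes *)

Lemma EnvP A m :
  reflect (m \in A /\ forall b, b \in A -> (mdeg m <= mdeg b)%N) (m \in Env A).
Proof. by rewrite !inE; apply: (iffP andP) => -[mA /allP]. Qed.

Lemma Env_var (i : 'I_n) : Env [fset U_(i)%MM] = [fset U_(i)%MM].
Proof.
apply/fsetP => m; apply/EnvP/idP => [[]//|mA]; split=> // b.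
by move: mA; rewrite !inE => /eqP -> /eqP ->.
Qed.

(** Degree is additive, so a sum has minimum degree exactly when both summands do. *)
Lemma Env_sumset B C : Env (sumset B C) = sumset (Env B) (Env C).
Proof.
apply/fsetP => m; apply/EnvP/sumsetP.
  case=> /sumsetP[b [c [bB cC ->]]] min_m; exists b, c.
  split=> //; apply/EnvP; split=> // d dA.
    have /min_m: (d + c)%MM \in sumset B C by apply/sumsetP; exists d, c.
    by rewrite !mdegD leq_add2r.
  have /min_m: (b + d)%MM \in sumset B C by apply/sumsetP; exists b, d.
  by rewrite !mdegD leq_add2l.
case=> b [c [/EnvP[bB bmin] /EnvP[cC cmin] ->]].
split; first by apply/sumsetP; exists b, c.
by move=> _ /sumsetP[d [e [dB eC ->]]]; rewrite !mdegD leq_add ?bmin ?cmin.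
Qed.

Lemma Env_fsetU_lt B C b : b \in B ->
  (forall c, c \in C -> (mdeg b < mdeg c)%N) -> Env (B `|` C) = Env B.
Proof.
move=> bB bC; apply/fsetP => m; apply/EnvP/EnvP => -[mA mmin].
  have mb : (mdeg m <= mdeg b)%N by apply: mmin; rewrite inE bB.
  split=> [|d dB]; last by apply: mmin; rewrite inE dB.
  by move: mA; rewrite inE => /orP[//|/bC]; rewrite ltnNge mb.
split=> [|d]; first by rewrite inE mA.
by rewrite inE => /orP[/mmin//|/bC bd]; apply: leq_trans (mmin _ bB) (ltnW bd).
Qed.

(** The cases compare the minimum degrees of [B] and [C]. Strict inequality is expressed by an
    element of one set lying below all of the other, which also covers empty sets. *)
Lemma Env_fsetU B C :
  [\/ Env (B `|` C) = Env B, Env (B `|` C) = Env C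
    | Env (B `|` C) = Env B `|` Env C].
Proof.
case: (altP (@hasP _ (fun b => all (fun c => mdeg b < mdeg c)%N (enum_fset C))
                     (enum_fset B))) => [[b bB /allP bC]|/hasPn nB].
  by apply: Or31; apply: Env_fsetU_lt bB bC.
case: (altP (@hasP _ (fun c => all (fun b => mdeg c < mdeg b)%N (enum_fset B))
                     (enum_fset C))) => [[c cC /allP cB]|/hasPn nC].
  by apply: Or32; rewrite fsetUC; apply: Env_fsetU_lt cC cB.
apply: Or33; apply/fsetP => m; rewrite inE; apply/EnvP/orP.
  case=> mA mmin; move: (mA); rewrite inE => /orP[mB|mC]; [left|right];
    by apply/EnvP; split=> // d dA; apply: mmin; rewrite inE dA ?orbT.
case=> /EnvP[mA mmin]; (split=> [|d]; first by rewrite inE mA ?orbT);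
  rewrite inE => /orP[dB|dC]; try exact: mmin.
(* Since [d] is not strictly below the whole other set, some [e] on the side of [m] has degree at
   most that of [d]. *)
- by have /allPn[e eB] := nC _ dC; rewrite -leqNgt; apply: leq_trans (mmin _ eB).
- by have /allPn[e eC] := nB _ dB; rewrite -leqNgt; apply: leq_trans (mmin _ eC).
Qed.

Let val s (g : gates n s) :=
  wire_val (fun i => [fset U_(i)%MM])
    (gate_val (fun i => [fset U_(i)%MM]) (fun B C => B `|` C) sumset g).

(** The map [phi] sends each old wire to a new wire carrying its envelope. Each old gate costs at
    most one new gate, whence [r <= s]. *)
Lemma gates_Env s (g : gates n s) :
  exists r (h : gates n r) (phi : 'I_n + 'I_s -> 'I_n + 'I_r),
    (r <= s)%N /\ forall v, val h (phi v) = Env (val g v).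
Proof.
elim: g => [|{}s g [r [h [phi [rs phiE]]]] l u w].
  by exists 0%N, NoGate, id; split=> // -[i|[]//]; rewrite /val /= Env_var.
have newE r' (k : gates n r') l' u' w' : val (AddGate k l' u' w') (inr ord_max)
    = label_op (fun B C => B `|` C) sumset l' (val k u') (val k w').
  exact: wire_val_new.
have oldE r' (k : gates n r') l' u' w' v :
    val (AddGate k l' u' w') (lift_wire v) = val k v.
  exact: wire_val_lift.
(* If the new gate has the same envelope as an earlier wire [v], no gate is added and [phi]
   redirects it to the image of [v]. *)
have bypass v : Env (val (AddGate g l u w) (inr ord_max)) = Env (val g v) ->
  exists r (h : gates n r) (phi : 'I_n + 'I_s.+1 -> 'I_n + 'I_r),
    (r <= s.+1)%N /\ forall v, val h (phi v) = Env (val (AddGate g l u w) v).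
  move=> vE; exists r, h, (fun v' => match v' with
    | inl i => phi (inl i)
    | inr j => phi (if unlift ord_max j is Some j' then inr j' else v) end).
  split=> [|[i|j]]; first exact: leqW.
    by rewrite phiE.
  by case: unliftP => [j' ->|->]; rewrite phiE ?vE ?(oldE _ _ _ _ _ (inr _)).
have keep : Env (val (AddGate g l u w) (inr ord_max)) =
    label_op (fun B C => B `|` C) sumset l (Env (val g u)) (Env (val g w)) ->
  exists r (h : gates n r) (phi : 'I_n + 'I_s.+1 -> 'I_n + 'I_r),
    (r <= s.+1)%N /\ forall v, val h (phi v) = Env (val (AddGate g l u w) v).
  move=> eE; exists r.+1, (AddGate h l (phi u) (phi w)).
  exists (fun v' => match v' with
    | inl i => lift_wire (phi (inl i))
    | inr j => if unlift ord_max j is Some j' then lift_wire (phi (inr j'))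
               else inr ord_max end).
  split=> [//|[i|j]]; first by rewrite oldE phiE.
  case: unliftP => [j' ->|->]; first by rewrite oldE phiE (oldE _ _ _ _ _ (inr _)).
  by rewrite eE -!phiE newE.
case: l bypass keep => bypass keep.
  by case: (Env_fsetU (val g u) (val g w)) => E;
    [apply: (bypass u)|apply: (bypass w)|apply: keep]; rewrite newE.
by apply: keep; rewrite newE Env_sumset.
Qed.

Lemma circuit_Env F :
  exists2 G : circuit n, (csize G <= csize F)%N & produced G = Env (produced F).
Proof.
have [r [h [phi [rs phiE]]]] := gates_Env (cgates F).
by exists (Circuit h (phi (coutput F))) => //; apply: phiE.
Qed.

(** * Existence of circuits *)

Lemma producedU F G : exists H : circuit n, produced H = produced F `|` produced G.
Proof. exact: (circuit_op _ _ _ gAdd). Qed.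

Lemma producedM F G :
  exists H : circuit n, produced H = sumset (produced F) (produced G).
Proof. exact: (circuit_op _ _ _ gMul). Qed.

(** Induction on a degree bound, splitting off one variable. As there are no constant inputs, the
    induction must stop at a single variable, when the quotient is [0%MM], and not at the empty
    product. *)
Lemma produced_monomial m : m != 0%MM -> exists F, produced F = [fset m].
Proof.
elim: (mdeg m) {-2}m (leqnn (mdeg m)) => {m}[|d IH] m md m0.
  by rewrite -mdeg_eq0 -leqn0 md in m0.
have [i mi] : exists i, m i != 0%N.
  apply/existsP; apply: contraR m0; rewrite negb_exists => /forallP m0.
  by apply/eqP/mnmP => i; rewrite mnm0E; apply/eqP; rewrite -[_ == _]negbK.
have mE : m = (U_(i) + (m - U_(i)))%MM.
  rewrite addmC submK //; apply/mnm_lepP => j.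
  by rewrite mnm1E; case: eqP => // <-; rewrite lt0n.
pose V := Circuit NoGate (inl i).
have VE : produced V = [fset U_(i)%MM] by [].
have [z|nz] := eqVneq (m - U_(i))%MM 0%MM.
  by exists V; rewrite mE z addm0.
have [|F FE] := IH _ _ nz.
  by rewrite {1}mE mdegD mdeg1 in md.
have [H HE] := producedM V F; exists H; rewrite HE VE FE; apply/fsetP => a.
apply/sumsetP/idP => [[b [c [/fset1P-> /fset1P-> ->]]]|/fset1P->].
  by rewrite -mE inE.
by exists U_(i)%MM, (m - U_(i))%MM; rewrite !inE -mE !eqxx.
Qed.

Lemma produced_exists A :
  A != fset0 -> 0%MM \notin A -> exists F, produced F = A.
Proof.
elim/fset1U_rect: A => [|m A _ IH _]; first by rewrite eqxx.
rewrite !inE negb_or eq_sym => /andP[m0 A0].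
have [F FE] := produced_monomial m0.
have [->|An] := eqVneq (A : {fset 'X_{1..n}}) fset0; first by exists F; rewrite fsetU0.
have [G GE] := IH An A0; have [H HE] := producedU F G.
by exists H; rewrite HE FE GE.
Qed.

End Produced.

(** * Minimal true points and read-1 circuits *)

Section LowVectors.
Variables (n : nat) (f : {ffun 'I_n -> bool} -> bool).
Implicit Types (F : circuit n) (a b : {ffun 'I_n -> bool}) (m : 'X_{1..n}).

Lemma LowP m :
  reflect (exists a, [/\ m = vec a, f a & forall b, point_le b a -> f b -> b = a])
          (m \in Low f).
Proof.
apply: (iffP (imfsetP _ _ _ _)) => [[a /andP[fa /forallP a_min] ->]|[a [-> fa a_min]]].
  exists a; split=> // b ba fb; apply/eqP; move: (a_min b).
  by rewrite ba fb /=; case: eqP.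
exists a => //; rewrite unfold_in /= fa; apply/forallP => b; apply/implyP => /andP[ba].
by apply: contra => fb; rewrite (a_min b).
Qed.

Lemma vecK : cancel (@vec n) (@supp_point n).
Proof. by move=> a; apply/ffunP => i; rewrite ffunE mnmE; case: (a i). Qed.

Lemma vec_supp_point_le m i : (vec (supp_point m) i <= m i)%N.
Proof. by rewrite mnmE ffunE; case: (m i). Qed.

Lemma vec_supp_point m : (forall i, m i <= 1)%N -> vec (supp_point m) = m.
Proof.
by move=> m1; apply/mnmP => i; rewrite mnmE ffunE; move: (m1 i); case: (m i) => [|[]].
Qed.

Lemma vec_le1 a i : (vec a i <= 1)%N.
Proof. by rewrite mnmE; case: (a i). Qed.

Lemma mdeg_le m m' : (forall i, m i <= m' i)%N -> (mdeg m <= mdeg m')%N.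
Proof. by move=> le_m; rewrite !mdegE; apply: leq_sum. Qed.

Lemma mdeg_le_eq m m' :
  (forall i, m i <= m' i)%N -> (mdeg m' <= mdeg m)%N -> m = m'.
Proof.
move=> le_m; have mE : m' = (m + (m' - m))%MM by rewrite addmC submK //; apply/mnm_lepP.
by rewrite {1}mE mdegD -{2}[mdeg m]addn0 leq_add2l leqn0 mdeg_eq0 => /eqP d0;
  rewrite mE d0 addm0.
Qed.

(** Among the true points below [a], one with the fewest ones is minimal. *)
Lemma Low_below a : f a -> exists b, [/\ vec b \in Low f, f b & point_le b a].
Proof.
move=> fa; pose P b := f b && point_le b a.
have Pa : P a by rewrite /P fa point_le_refl.
case: (arg_minnP (fun b => mdeg (vec b)) Pa) => b /andP[fb /forallP ba] b_min.
exists b; split=> //; last exact/forallP.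
apply/LowP; exists b; split=> // c /forallP cb fc; apply: (can_inj vecK).
apply: mdeg_le_eq => [i|]; first by rewrite !mnmE; move: (cb i); do 2 case: (_ i).
apply: b_min; rewrite /P fc; apply/forallP => i; apply/implyP => ci.
by move: (ba i) (cb i); rewrite ci /= => /implyP h /h.
Qed.

Lemma supp_point_Low m : m \in Low f -> f (supp_point m).
Proof. by case/LowP => a [-> fa _]; rewrite vecK. Qed.

Lemma supp_supp_point m m' : supp m = supp m' -> supp_point m = supp_point m'.
Proof. by move/setP => mE; apply/ffunP => i; move: (mE i); rewrite !inE !ffunE. Qed.

Hypothesis f_mono : monotone_fun f.

Lemma arith_sread F : produced F = Low f -> sread_circuit 1 F f.
Proof.
move=> FE; split=> [a|b]; last by rewrite FE => /LowP[a [-> _ _]] i; apply: vec_le1.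
apply/idP/idP => [/bool_valP[b]|fa].
  by rewrite FE => /supp_point_Low fb ba; apply: f_mono ba fb.
have [b [bL fb ba]] := Low_below fa.
by apply/bool_valP; exists (vec b); rewrite ?FE ?vecK.
Qed.

(** The circuit is true at a minimal point [a], so some produced [b] has support below [a]. The
    circuit is also true at the support of [b], and minimality of [a] makes the two equal. *)
Lemma sread_read F k : sread_circuit k F f -> read_circuit k F f.
Proof.
case=> Ff Fk; split=> // m /LowP[a [-> fa a_min]].
have /bool_valP[b bF ba] : bool_val F a by rewrite Ff.
exists b; split=> //; last exact: Fk.
have: supp_point b = a by apply: a_min => //; rewrite -Ff; apply: produced_true.
by move/ffunP => bE; apply/setP => i; rewrite !inE mnmE -bE ffunE; case: (b i).
Qed.

Lemma read1_Env F : read_circuit 1 F f -> Env (produced F) = Env (Low f).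
Proof.
case=> Ff F1.
(* A vector with entries at most 1 is determined by its support, so the read-1 witness for [m] is
   [m] itself. *)
have LowF m : m \in Low f -> m \in produced F.
  move=> mL; have [b [bF /supp_supp_point bm b1]] := F1 m mL.
  have /LowP[a [mE _ _]] := mL.
  by rewrite mE -(vecK a) -mE -bm vec_supp_point.
have FLow m : m \in produced F -> exists2 l, l \in Low f & forall i, (l i <= m i)%N.
  move=> mF; have := produced_true mF; rewrite Ff => /Low_below[a [aL _ /forallP am]].
  exists (vec a) => // i; apply: leq_trans (vec_supp_point_le m i).
  by move: (am i); rewrite !mnmE; do 2 case: (fun_of_fin _ i).
apply/fsetP => m; apply/EnvP/EnvP => -[mA m_min]; last first.
  split=> [|b /FLow[l lL lb]]; first exact: LowF.
  exact: leq_trans (m_min l lL) (mdeg_le lb).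
split=> [|b /LowF/m_min//].
(* The vector [l] below [m] is itself produced, so minimality of [m] forces equal degrees and hence
   [l = m]. *)
have [l lL lm] := FLow m mA.
by rewrite -(mdeg_le_eq lm (m_min _ (LowF _ lL))).
Qed.

Hypothesis f_nonconst : ~ constant_fun f.

Lemma Low_producible : exists F, produced F = Low f.
Proof.
pose z : {ffun 'I_n -> bool} := [ffun=> false].
(* A monotone function true at the origin is constantly true. This keeps the zero vector, which no
   circuit produces, out of [Low f]. *)
have fz : f z = false.
  apply: contra_notF f_nonconst => fz; exists true => a; apply: f_mono fz.
  by apply/forallP => i; rewrite ffunE.
apply: produced_exists.
  have [a fa|f0] := pickP f; last by case: f_nonconst; exists false.
  have [b [bL _ _]] := Low_below fa.
  by apply/fset0Pn; exists (vec b).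
apply/negP => /supp_point_Low; suff -> : supp_point 0%MM = z by rewrite fz.
by apply/ffunP => i; rewrite !ffunE mnm0E.
Qed.

End LowVectors.

(** * Homogeneity, minimum sizes and the chain of inequalities *)

Lemma homogeneous_Env n (f : {ffun 'I_n -> bool} -> bool) :
  homogeneous_fun f -> Env (Low f) = Low f.
Proof.
move=> f_hom; apply/fsetP => m; apply/EnvP/idP => [[]//|mL].
by split=> // b bL; rewrite (f_hom m b).
Qed.

(** Descent on the size; excluded middle decides whether a smaller circuit satisfies the arbitrary
    predicate [P]. *)
Lemma is_min_size_exists n (P : circuit n -> Prop) F :
  P F -> exists s, is_min_size P s.
Proof.
have [k] := ubnP (csize F); elim: k F => // k IH F; rewrite ltnS => Fk PF.
have [[G [PG GF]]|noG] := classic (exists G, P G /\ (csize G < csize F)%N).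
  by apply: (IH G) => //; apply: leq_trans Fk.
exists (csize F); split=> [|G PG]; first by exists F.
by rewrite leqNgt; apply/negP => GF; apply: noG; exists G.
Qed.

Lemma is_min_size_leq n (P Q : circuit n -> Prop) s t :
  is_min_size P s -> is_min_size Q t ->
  (forall F, Q F -> exists2 G, P G & (csize G <= csize F)%N) -> (s <= t)%N.
Proof.
by move=> [_ s_min] [[F [QF <-]] _] /(_ F QF)[G /s_min sG]; apply: leq_trans.
Qed.

Theorem theorem1 (n : nat) (f : {ffun 'I_n -> bool} -> bool)
    (f_mono : monotone_fun f) (f_nonconst : ~ constant_fun f) :
  exists arithEnv read1 sread1 arithLow : nat,
    [/\ is_Arith (Env (Low f)) arithEnv, is_Read 1 f read1,
        is_sRead 1 f sread1 & is_Arith (Low f) arithLow] /\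
    [/\ (arithEnv <= read1)%N, (read1 <= sread1)%N & (sread1 <= arithLow)%N] /\
    (homogeneous_fun f -> arithLow = read1 /\ read1 = sread1).
Proof.
have arith_sread1 F : arith_circuit F (Low f) -> sread_circuit 1 F f.
  by move/arith_circuitP; apply: arith_sread.
have read1_arith F : read_circuit 1 F f ->
    exists2 G, arith_circuit G (Env (Low f)) & (csize G <= csize F)%N.
  move=> /read1_Env FE; have [G GF GE] := circuit_Env F.
  by exists G => //; apply/arith_circuitP; rewrite GE.
(* This one circuit for [Low f] yields a witness for each of the four minima. *)
have [F /arith_circuitP FL] := Low_producible f_mono f_nonconst.
have Fs := arith_sread1 F FL; have Fr := sread_read Fs.
have [G GE _] := read1_arith F Fr.
have [sE min_E] : exists s, is_Arith (Env (Low f)) s :=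
  is_min_size_exists GE.
have [sr min_r] : exists s, is_Read 1 f s :=
  is_min_size_exists Fr.
have [ss min_s] : exists s, is_sRead 1 f s :=
  is_min_size_exists Fs.
have [sL min_L] : exists s, is_Arith (Low f) s :=
  is_min_size_exists FL.
exists sE, sr, ss, sL; split=> //.
have Er : (sE <= sr)%N by apply: is_min_size_leq min_E min_r read1_arith.
have rs : (sr <= ss)%N.
  by apply: is_min_size_leq min_r min_s _ => H /sread_read ?; exists H.
have sL' : (ss <= sL)%N.
  by apply: is_min_size_leq min_s min_L _ => H /arith_sread1 ?; exists H.
split=> // f_hom.
(* For homogeneous [f] the two ends of the chain measure the same set, so all the inequalities
   collapse. *)
have LE : (sL <= sE)%N.
  by apply: is_min_size_leq min_L min_E _ => H; rewrite homogeneous_Env //; exists H.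
have Lr : sL = sr.
  by apply/eqP; rewrite eqn_leq (leq_trans LE Er) (leq_trans rs sL').
by split=> //; apply/eqP; rewrite eqn_leq rs -Lr sL'.
Qed.
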